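(* If $H$ is a $3$-graph with maximum degree at most $\Delta$, then $$\mathrm{ex}(H,\mathcal{C}_5^3)\ge \Delta^{-3/4-o(1)}\cdot e(H).$$
   Context: A $3$-graph is a $3$-uniform hypergraph; $e(H)$ is its number of edges; the maximum degree is the maximum number of edges containing a given vertex. For a family $\mathcal{F}$ of $3$-graphs, $\mathrm{ex}(H,\mathcal{F})$ is the maximum number of edges in a subgraph of $H$ containing no subgraph isomorphic to a member of $\mathcal{F}$. $\mathcal{C}_5^3$ is the set of all $3$-uniform Berge $5$-cycles: $3$-graphs with exactly $5$ distinct edges $e_1,\dots,e_5$ for which there are distinct vertices $v_1,\dots,v_5$ with $v_i,v_{i+1}\in e_i$ for $1\le i<5$ and $v_5,v_1\in e_5$. Asymptotics are as $\Delta\to\infty$: for every $\varepsilon>0$ there is $\Delta_0$ such that for all $\Delta\ge\Delta_0$ and all $3$-graphs $H$ with maximum degree at most $\Delta$ the inequality holds with $o(1)$ replaced by $\varepsilon$. *)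

(* Defs.v *)
From mathcomp Require Import all_boot all_order all_algebra.
From mathcomp Require Import boolp reals exp.

Set Implicit Arguments.
Unset Strict Implicit.
Unset Printing Implicit Defensive.

Record hypergraph := Hypergraph {
  vertex : finType;
  edges : {set {set vertex}} }.

Definition uniform (k : nat) (H : hypergraph) : Prop :=
  forall e, e \in edges H -> #|e| = k.

Record graph3 := Graph3 {
  graph3_hypergraph :> hypergraph;
  graph3_uniform : uniform 3 graph3_hypergraph }.

Definition max_degree (H : hypergraph) : nat :=
  \max_(x : vertex H) #|[set e in edges H | x \in e]|.

(* [phi] is an isomorphism of [F] onto a subgraph of [H]. *)
Definition contains_copy (F H : hypergraph) : Prop :=
  exists phi : vertex F -> vertex H,
    injective phi /\ forall e, e \in edges F -> phi @: e \in edges H.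

Definition family3 := graph3 -> Prop.

Definition is_free (FF : family3) (H : hypergraph) : Prop :=
  forall F : graph3, FF F -> ~ contains_copy F H.

(* A subgraph is given by its set of edges, on the vertices of [H].  If every
   subgraph contains a member of [FF], i.e. if the edgeless one does, the
   maximum is over the empty set and [turan_ex H FF] is 0. *)
Definition turan_ex (H : hypergraph) (FF : family3) : nat :=
  \max_(E : {set {set vertex H}} |
          (E \subset edges H) && `[< is_free FF (Hypergraph E) >]) #|E|.

(* [ordS] is the cyclic successor on ['I_k]: the last edge contains the last
   and the first vertices. *)
Definition berge_cycle (k : nat) : family3 := fun F =>
  exists (e : 'I_k -> {set vertex F}) (v : 'I_k -> vertex F),
    [/\ injective e, edges F = [set e i | i : 'I_k], injective v &
        forall i, v i \in e i /\ v (ordS i) \in e i].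

(* Main.v *)
(** The argument gives [Omega(Delta^(-3/4)) * e(H)], and [Delta ^ eps] absorbs
    the constant.

    A random partition makes [H] tripartite, with an edge [e] written
    [X e, Y e, Z e].  Let [16^k] be of order [Delta], so that [4^k] is of order
    [sqrt Delta], and let [G] be the point-line incidence graph of an affine
    plane over GF(2^j): it has no 4-cycle, has [4^j] vertices on each side and
    density [2^-j].

    If all pairs have codegree at most about [4^k], take [j = k], colour the
    vertices of [H] by the vertices of [G], keep the edges with [X e ~ Y e] in
    [G] and [Z e] coloured as [Y e], and delete those that meet an edge with
    the same colours.  An edge survives with probability about [8^-k].  A
    Berge pentagon would map to a closed walk in [G] that never uses an edge
    twice in a row, which forces a 4-cycle.

    Otherwise some pair of parts, say [(Y, Z)], often has large codegree, about
    [4^j / 16] with [k <= j <= 2k].  Then a vertex has at most [4^(2k-j)] such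
    neighbours across the pair, and [4^(2k+2-j)] further colours select a
    random matching of these pairs, at a cost of [4^(2k+2-j)]; the incidences
    of [X e] with the matching are then sparsified by [G] at a cost of [2^j].
    The total cost [16 * 8^k / 2^(j-k)] is geometric in [j], so that summing
    over [j] loses only a constant. *)
Require Import Defs.
From mathcomp Require Import all_boot all_order all_algebra finfield.
From mathcomp Require Import boolp reals exp.
From mathcomp Require Import zify ring.

Set Implicit Arguments.
Unset Strict Implicit.
Unset Printing Implicit Defensive.

Import Order.TTheory GRing.Theory Num.Theory.

(** * Counting colourings *)

(* Resampling the coordinate [rd] of [w] is independent of [P] and [g], so a
   prescribed value is hit exactly once in [#|K|]. *)
Lemma card_resample (W K : finType) (rd : W -> K) (up : W -> K -> W)
    (P : pred W) (g : W -> K) :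
  (forall w k, rd (up w k) = k) -> (forall w, up w (rd w) = w) ->
  (forall w k l, up (up w k) l = up w l) ->
  (forall w k, P (up w k) = P w) -> (forall w k, g (up w k) = g w) ->
  (#|[pred w | P w & rd w == g w]| * #|K|)%N = #|P|.
Proof.
move=> rdK upK upup Pup gup.
rewrite -cardX -(@card_in_imset _ _ (fun u : W * K => up u.1 u.2)).
  apply/esym/eq_card => w; apply/idP/imsetP => [Pw | [[w1 k]]].
    exists (up w (g w), rd w); last by rewrite /= upup upK.
    rewrite !inE /= Pup rdK gup eqxx !andbT.
    exact: Pw.
  by rewrite !inE /= => /andP[/andP[Pw _] _] ->; rewrite unfold_in Pup.
move=> [w k] [w1 k1] /=; rewrite !inE /= => /andP[/andP[_ /eqP e] _].
move=> /andP[/andP[_ /eqP e1] _] E.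
have Ek : k = k1 by rewrite -(rdK w k) E rdK.
suff Ew : w = w1 by rewrite Ek Ew.
rewrite -(upK w) -(upK w1) e e1 -(gup w k) E gup.
by rewrite -(upup w k) E upup.
Qed.

Definition recolor (V C : finType) (f : {ffun V -> C}) (v : V) (c : C) :
  {ffun V -> C} := [ffun u => if u == v then c else f u].

Lemma recolor_id (V C : finType) (f : {ffun V -> C}) v c : recolor f v c v = c.
Proof. by rewrite ffunE eqxx. Qed.

Lemma recolor_neq (V C : finType) (f : {ffun V -> C}) v c u :
  u != v -> recolor f v c u = f u.
Proof. by move=> /negPf nuv; rewrite ffunE nuv. Qed.

(** [pr] and [mk] read and overwrite one component of a colour and leave the rest alone, so that the
    components of a product colour can be resampled, and charged for, separately. *)
Lemma card_recolor (V C K : finType) (v : V) (pr : C -> K) (mk : C -> K -> C)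
    (P : pred {ffun V -> C}) (g : {ffun V -> C} -> K) :
  (forall c k, pr (mk c k) = k) -> (forall c, mk c (pr c) = c) ->
  (forall c k l, mk (mk c k) l = mk c l) ->
  (forall f k, P (recolor f v (mk (f v) k)) = P f) ->
  (forall f k, g (recolor f v (mk (f v) k)) = g f) ->
  (#|[pred f | P f & pr (f v) == g f]| * #|K|)%N = #|P|.
Proof.
move=> prK mkK mkmk Pr gr.
pose up (f : {ffun V -> C}) k := recolor f v (mk (f v) k).
apply: (@card_resample _ _ (fun f : {ffun V -> C} => pr (f v)) up) => //.
- by move=> f k; rewrite recolor_id prK.
- by move=> f; apply/ffunP => u; rewrite ffunE; case: eqP => // ->; rewrite mkK.
- by move=> f k l; apply/ffunP => u; rewrite !ffunE eqxx; case: eqP; rewrite ?mkmk.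
Qed.

Lemma card_recolor_full (V C : finType) (v : V) (P : pred {ffun V -> C})
    (g : {ffun V -> C} -> C) :
  (forall f c, P (recolor f v c) = P f) ->
  (forall f c, g (recolor f v c) = g f) ->
  (#|[pred f | P f & f v == g f]| * #|C|)%N = #|P|.
Proof.
move=> Pr gr.
by apply: (@card_recolor _ _ _ _ id (fun _ c => c)) => // *; rewrite ?Pr ?gr.
Qed.

Lemma card_union_bound (W I : finType) (P : pred W) (Q : I -> pred W)
    (S : {set I}) (M : nat) :
  (forall i, i \in S -> #|[pred w | P w & Q i w]| * M <= #|P|)%N ->
  (#|[pred w | P w & [exists i in S, Q i w]]| * M <= #|S| * #|P|)%N.
Proof.
move=> PQ.
apply: (@leq_trans (\sum_(i in S) #|[pred w | P w & Q i w]| * M)); last first.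
  by rewrite -sum_nat_const; apply: leq_sum.
rewrite -big_distrl /= leq_mul2r; apply/orP; right.
under eq_bigr => i _ do rewrite -sum1_card big_mkcond /=.
rewrite exchange_big /= -sum1_card big_mkcond /=; apply: leq_sum => w _.
rewrite !inE; case: ifP => // /andP[Pw /'exists_andP[i [Si Qi]]].
rewrite (bigD1 i) //= ifT //; exact/andP.
Qed.

(** First-moment method, with [L] an inverse probability: double count the pairs of an outcome and
    an element of [E] that it keeps. *)
Lemma exists_large_outcome (W I : finType) (E : {set I}) (P : W -> pred I)
    (L : nat) :
  (0 < #|W|)%N ->
  (forall e, e \in E -> #|W| <= L * #|[pred w | P w e]|)%N ->
  exists w, (#|E| <= L * #|[set e in E | P w e]|)%N.
Proof.
move=> W0 PL; apply/existsP; apply: contraT; rewrite negb_exists => /forallP lt.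
have : (\sum_(w : W) L * #|[set e in E | P w e]| < #|W| * #|E|)%N.
  rewrite -sum_nat_const.
  (* Splitting off one outcome makes the inequality between the sums strict. *)
  have [w0 _] : exists w0 : W, w0 \in W by apply/card_gt0P.
  rewrite (bigD1 w0) // [ltnRHS](bigD1 w0) //= -addSn leq_add //.
    by rewrite ltnNge lt.
  by apply: leq_sum => w _; rewrite ltnW // ltnNge lt.
rewrite ltnNge -big_distrr /= => /negP[].
under eq_bigr => w _ do rewrite -sum1_card big_mkcond /=.
rewrite exchange_big big_distrr /= mulnC -sum_nat_const [leqLHS]big_mkcond /=.
apply: leq_sum => e _; case: ifP => // eE.
apply: leq_trans (PL e eE) _; rewrite leq_mul2l; apply/orP; right.
rewrite -sum1_card big_mkcond /=; apply: leq_sum => w _.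
by rewrite !inE eE.
Qed.

(** * Excluding Berge pentagons *)

(** The parts are encoded by selectors on edges. The inequalities range over two edges, so that a
    vertex plays the same role in every edge of [E] that contains it. *)
Definition tripartite (V : finType) (E : {set {set V}})
    (X Y Z : {set V} -> V) : Prop :=
  [/\ {in E, forall e, e = [set X e; Y e; Z e]},
      {in E &, forall e e', X e != Y e'},
      {in E &, forall e e', X e != Z e'} &
      {in E &, forall e e', Y e != Z e'}].

Definition touching (V : finType) (X Y Z : {set V} -> V) (e e' : {set V}) :=
  [|| X e' == X e, Y e' == Y e | Z e' == Z e].

(* A cyclic link [None] keeps the row and changes the column, a link [Some _]
   does the opposite.  Columns cannot change exactly once, at most two of five
   cyclic links are [None] if no two consecutive ones agree, and five
   alternating links [Some _] do not close up; two [None] links produce a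
   4-cycle of [adj]. *)
Lemma no_rook_pentagon (A B : Type) (adj : A -> B -> Prop)
    (a : 'I_5 -> A) (b : 'I_5 -> B) (t : 'I_5 -> option bool) :
  (forall p p' l l', adj p l -> adj p l' -> adj p' l -> adj p' l' ->
     p = p' \/ l = l') ->
  (forall i, adj (a i) (b i)) ->
  (forall i, t i <> t (ordS i)) ->
  (forall i, if t i is None then a i = a (ordS i) /\ b i <> b (ordS i)
             else b i = b (ordS i) /\ a i <> a (ordS i)) ->
  False.
Proof.
move=> C4 adjab tn step.
set i0 : 'I_5 := ord0; pose i1 := ordS i0; pose i2 := ordS i1.
pose i3 := ordS i2; pose i4 := ordS i3.
have i40 : ordS i4 = i0 by exact: val_inj.
move: (adjab i0) (adjab i1) (adjab i2) (adjab i3) (adjab i4).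
move: (tn i0) (tn i1) (tn i2) (tn i3) (tn i4).
move: (step i0) (step i1) (step i2) (step i3) (step i4).
rewrite i40 -/i1 -/i2 -/i3 -/i4.
move: (a i0) (a i1) (a i2) (a i3) (a i4) => a0 a1 a2 a3 a4.
move: (b i0) (b i1) (b i2) (b i3) (b i4) => b0 b1 b2 b3 b4.
case: (t i0) => [[]|]; case: (t i1) => [[]|] //;
case: (t i2) => [[]|] //; case: (t i3) => [[]|] //; case: (t i4) => [[]|] //;
  move=> [E0 N0] [E1 N1] [E2 N2] [E3 N3] [E4 N4] _ _ _ _ _ H0 H1 H2 H3 H4;
  subst; try congruence.
all: match goal with
  | [ C4 : (forall _ _ _ _, _), H1 : ?r ?p ?l, H2 : ?r ?p ?l', H3 : ?r ?p' ?l,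
      H4 : ?r ?p' ?l' |- _ ] =>
    by case: (C4 p p' l l' H1 H2 H3 H4); congruence end.
Qed.

(** Sending [e] to the pair [(a e, b e)] turns a Berge pentagon into a closed walk on edges of
    [adj]. A vertex shared by consecutive edges fixes [a] or [b], according to its part, and
    injectivity on touching edges makes the other coordinate change, as [no_rook_pentagon]
    forbids. *)
Lemma berge5_free_of_coloring (V : finType) (E : {set {set V}})
    (X Y Z : {set V} -> V) (A B : eqType) (adj : A -> B -> Prop)
    (a : {set V} -> A) (b : {set V} -> B) :
  tripartite E X Y Z ->
  (forall p p' l l', adj p l -> adj p l' -> adj p' l -> adj p' l' ->
     p = p' \/ l = l') ->
  {in E, forall e, adj (a e) (b e)} ->
  {in E &, forall e e', X e = X e' -> a e = a e'} ->
  {in E &, forall e e', Y e = Y e' -> b e = b e'} ->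
  {in E &, forall e e', Z e = Z e' -> b e = b e'} ->
  {in E &, forall e e', touching X Y Z e e' -> a e' = a e -> b e' = b e ->
     e' = e} ->
  is_free (berge_cycle 5) (Hypergraph E).
Proof.
move=> [def_e XY XZ YZ] C4 adjE aX bY bZ inj F [e [v [ei eE vi ve]]].
case=> phi [phii phiE].
pose d i : {set V} := phi @: e i.
have dE i : d i \in E by apply: phiE; rewrite eE; apply/imsetP; exists i.
have dn i : d i <> d (ordS i).
  move=> /(imset_inj phii) /ei /(congr1 val) /=.
  by case: i => [[|[|[|[|[]]]]]].
(* The index is shifted because the successor vertex is the one common to [d i] and [d (ordS i)]. *)
pose w i : V := phi (v (ordS i)).
have wd i : w i \in d i by apply: imset_f; case: (ve i).
have wdS i : w i \in d (ordS i) by apply: imset_f; case: (ve (ordS i)).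
have wn i : w i <> w (ordS i).
  by move=> /phii /vi /(congr1 val) /=; case: i => [[|[|[|[|[]]]]]].
(* The part of the shared vertex: [None] for [X], [Some true] for [Y], [Some false] for [Z]. *)
pose t i := if w i == X (d i) then None else Some (w i == Y (d i)).
have tP i e' : e' \in E -> w i \in e' ->
    match t i with None => w i = X e' | Some true => w i = Y e'
    | Some false => w i = Z e' end.
  move=> e'E we'; have := wd i; move: we'; have di := dE i.
  rewrite {1}(def_e _ e'E) {1}(def_e _ di) !inE -!orbA /t.
  case/or3P=> /eqP Ew; case/or3P=> /eqP Ed.
  - by rewrite -Ed eqxx.
  - by have := XY _ _ e'E di; rewrite -Ew -Ed eqxx.
  - by have := XZ _ _ e'E di; rewrite -Ew -Ed eqxx.
  - by have := XY _ _ di e'E; rewrite -Ew -Ed eqxx.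
  - by have /negPf := XY _ _ di di; rewrite eq_sym -Ed eqxx => ->.
  - by have := YZ _ _ e'E di; rewrite -Ew -Ed eqxx.
  - by have := XZ _ _ di e'E; rewrite -Ew -Ed eqxx.
  - by have := YZ _ _ di e'E; rewrite -Ew -Ed eqxx.
  - have /negPf := XZ _ _ di di; have /negPf := YZ _ _ di di.
    by rewrite ![_ == Z _]eq_sym -Ed => -> ->.
apply: (@no_rook_pentagon A B adj (a \o d) (b \o d) t) => //.
- by move=> i; apply: adjE.
(* If [w i] and [w (ordS i)] lay in the same part, both would be the vertex of [d (ordS i)] in that
   part. *)
- move=> i tt.
  have := tP i _ (dE _) (wdS i).
  have := tP (ordS i) _ (dE _) (wd _).
  by rewrite -tt; case: (t i) => [[]|] hS h; apply: (wn i); rewrite hS h.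
- move=> i /=.
  have := tP i _ (dE _) (wdS i).
  have := tP i _ (dE _) (wd _).
  have dn' := dn i.
  have := inj _ _ (dE i) (dE (ordS i)).
  case: (t i) => [[]|] tch h hS; move: (etrans (esym h) hS) => eq.
  + have bb := bY _ _ (dE i) (dE _) eq; split=> // aa; apply: dn'.
    by apply/esym/tch => //; rewrite /touching eq eqxx !orbT.
  + have bb := bZ _ _ (dE i) (dE _) eq; split=> // aa; apply: dn'.
    by apply/esym/tch => //; rewrite /touching eq eqxx !orbT.
  + have aa := aX _ _ (dE i) (dE _) eq; split=> // bb; apply: dn'.
    by apply/esym/tch => //; rewrite /touching eq eqxx.
Qed.

(** * The point-line incidence graph of an affine plane *)

Local Open Scope ring_scope.

(** [l] encodes the line of slope [l.1] and intercept [- l.2]. Vertical lines are left out, so that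
    points and lines are both pairs over [F]. *)
Definition incident (F : fieldType) (p l : F * F) : bool :=
  p.2 == p.1 * l.1 - l.2.

(** Eliminating ordinates and intercepts from the four equations leaves the product of the
    differences of abscissas and of slopes, which must vanish. *)
Lemma incident_C4_free (F : fieldType) (p p' l l' : F * F) :
  incident p l -> incident p l' -> incident p' l -> incident p' l' ->
  p = p' \/ l = l'.
Proof.
case: p p' l l' => [a b] [a' b'] [c d] [c' d']; rewrite /incident /=.
move=> /eqP -> /eqP h1 /eqP -> /eqP h2.
have e0 : (a - a') * (c - c') = 0.
  have -> : (a - a') * (c - c') = (a * c - d - (a * c' - d'))
                                 - (a' * c - d - (a' * c' - d')) by ring.
  by rewrite h1 h2 !subrr.
have/orP[/eqP/subr0_eq ea|/eqP/subr0_eq ec] : (a - a' == 0) || (c - c' == 0).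
  by rewrite -mulf_eq0 e0.
- by left; rewrite ea.
- right; rewrite -ec in h1 *; congr (_, _).
  by move/addrI/oppr_inj: h1.
Qed.
Local Close Scope ring_scope.

(** * Random subgraphs *)

Definition degree (V : finType) (E : {set {set V}}) (P : {set V} -> V) e :=
  #|[set e' in E | P e' == P e]|.

Definition codegree (V : finType) (E : {set {set V}}) (P Q : {set V} -> V) e :=
  #|[set e' in E | (P e' == P e) && (Q e' == Q e)]|.

(** Chains the fractions [B / K <= t / m <= j / c]: a union bound followed by a numerical
    hypothesis. *)
Lemma leq_ratio (B K m t c j : nat) :
  0 < m -> B * m <= t * K -> c * t <= j * m -> c * B <= j * K.
Proof.
move=> m0 Bm ct; rewrite -(leq_pmul2r m0).
apply: leq_trans (_ : c * t * K <= _); first by rewrite -!mulnA leq_mul2l Bm orbT.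
by rewrite [leqRHS]mulnAC leq_mul2r ct orbT.
Qed.

Lemma half_survives (W : finType) (P Q : pred W) :
  2 * #|[pred w | P w & Q w]| <= #|P| -> #|P| <= 2 * #|[pred w | P w & ~~ Q w]|.
Proof.
have := cardID Q P.
have -> : #|[predI P & Q]| = #|[pred w | P w & Q w]| by apply: eq_card.
have -> : #|[predD P & Q]| = #|[pred w | P w & ~~ Q w]|.
  by apply: eq_card => w; rewrite !inE andbC.
lia.
Qed.

Lemma card_orb_leq (W : finType) (P Q R : pred W) :
  #|[pred w | P w & Q w || R w]|
    <= #|[pred w | P w & Q w]| + #|[pred w | P w & R w]|.
Proof.
rewrite -cardUI; apply: leq_trans (leq_addr _ _).
by apply/subset_leq_card/subsetP => w; rewrite !inE andb_orr.
Qed.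

(** The boolean exponent covers coinciding vertices, which agree with certainty. *)
Lemma card_same_color (V C : finType) (v v' : V) (P : pred {ffun V -> C}) :
  (v' != v -> forall f c, P (recolor f v' c) = P f) ->
  #|[pred f | P f & f v' == f v]| * #|C| ^ (v' != v) = #|P|.
Proof.
move=> Pr; case: eqVneq Pr => [-> _ | ne Pr] /=.
  by rewrite muln1; apply: eq_card => f; rewrite !inE eqxx andbT.
apply: (card_recolor_full (g := fun f => f v)); first exact: Pr.
by move=> f c; rewrite recolor_neq // eq_sym.
Qed.

(** The incidence equation prescribes the second coordinate of the point at [x], the one that [mk]
    resamples. *)
Lemma card_incident (V C : finType) (F : finFieldType) (x y : V)
    (pt : C -> F * F) (mk : C -> F -> C) :
  (forall c k, pt (mk c k) = ((pt c).1, k)) ->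
  (forall c, mk c (pt c).2 = c) ->
  (forall c k l, mk (mk c k) l = mk c l) ->
  x != y ->
  #|[pred f : {ffun V -> C} | incident (pt (f x)) (pt (f y))]| * #|F|
    = #|{ffun V -> C}|.
Proof.
move=> ptmk mkpt mkmk xy.
rewrite -[RHS](@card_recolor V C F x (fun c => (pt c).2) mk predT
   (fun f => (pt (f x)).1 * (pt (f y)).1 - (pt (f y)).2)%R) //.
- by move=> c k; rewrite ptmk.
- by move=> f k; rewrite recolor_id recolor_neq 1?eq_sym // ptmk.
Qed.

(** Keeping [e] costs [#|F|] for the incidence and [#|F| ^ 2] for the colour of [Z e]. Given this,
    each of the at most [3 * T] edges sharing two vertices with [e] copies its colours with
    probability [#|F| ^ -2], and each of the at most [3 * D] sharing one with probability
    [#|F| ^ -4]. Either kind of conflict has probability at most 3/16, so at least half of the kept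
    outcomes survive. *)
Lemma light_free_subgraph (V : finType) (E : {set {set V}})
    (X Y Z : {set V} -> V) (F : finFieldType) (D T : nat) :
  tripartite E X Y Z ->
  {in E, forall e, [/\ degree E X e <= D, degree E Y e <= D & degree E Z e <= D]} ->
  {in E, forall e,
     [/\ codegree E X Y e <= T, codegree E X Z e <= T & codegree E Y Z e <= T]} ->
  16 * D <= #|F| ^ 4 -> 16 * T <= #|F| ^ 2 ->
  exists E' : {set {set V}}, [/\ E' \subset E,
    is_free (berge_cycle 5) (Hypergraph E') & #|E| <= 2 * #|F| ^ 3 * #|E'|].
Proof.
move=> triE degE codE D16 T16; have [def_e XY XZ YZ] := triE.
pose C : finType := (F * F)%type.
have cC : #|C| = #|F| ^ 2 by rewrite card_prod.
have F0 : 0 < #|F| by apply/card_gt0P; exists 0%R.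
pose keep e : pred {ffun V -> C} :=
  fun f => incident (f (X e)) (f (Y e)) && (f (Z e) == f (Y e)).
pose same e' e : pred {ffun V -> C} := fun f =>
  [&& f (X e') == f (X e), f (Y e') == f (Y e) & f (Z e') == f (Z e)].
(* Each part where the edges differ costs a factor [#|C|]; [S 1 e] and [S 2 e] are the edges sharing
   two vertices and one vertex with [e]. *)
pose diff e' e : nat := (X e' != X e) + (Y e' != Y e) + (Z e' != Z e).
pose S j e := [set e' in E | diff e' e == j].
pose bad e : pred {ffun V -> C} := fun f =>
  [exists e' in S 1 e, same e' e f] || [exists e' in S 2 e, same e' e f].
have card_keep e : e \in E -> #|{ffun V -> C}| = #|F| ^ 3 * #|keep e|.
  move=> eE; rewrite -(@card_incident V C F (X e) (Y e) id (fun c k => (c.1, k))) //;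
    [| by case | exact: XY].
  pose P0 : pred {ffun V -> C} := fun f => incident (f (X e)) (f (Y e)).
  rewrite -(@card_recolor_full V C (Z e) P0 (fun f => f (Y e))).
  - by rewrite cC -mulnA -expnSr mulnC.
  - by move=> f c; rewrite /P0 !recolor_neq ?XZ ?YZ.
  - by move=> f c; rewrite recolor_neq ?YZ.
have card_same e e' : e \in E -> e' \in E ->
    #|[pred f | keep e f & same e' e f]| * #|C| ^ diff e' e = #|keep e|.
  move=> eE e'E.
  have [XYn XZn YZn] := And3 (XY _ _ eE e'E) (XZ _ _ eE e'E) (YZ _ _ eE e'E).
  have [YXn ZXn ZYn] := And3 (XY _ _ e'E eE) (XZ _ _ e'E eE) (YZ _ _ e'E eE).
  have [n1 n2 n3] := And3 (XY _ _ e'E e'E) (XZ _ _ e'E e'E) (YZ _ _ e'E e'E).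
  pose P1 : pred {ffun V -> C} := fun f => keep e f && (f (X e') == f (X e)).
  pose P2 : pred {ffun V -> C} := fun f => P1 f && (f (Y e') == f (Y e)).
  rewrite -(@card_same_color V C (X e) (X e') (keep e)); last first.
    by move=> ne f c; rewrite /keep !recolor_neq // eq_sym.
  rewrite -(@card_same_color V C (Y e) (Y e') P1); last first.
    by move=> ne f c; rewrite /P1 /keep !recolor_neq // eq_sym.
  rewrite -(@card_same_color V C (Z e) (Z e') P2); last first.
    by move=> ne f c; rewrite /P2 /P1 /keep !recolor_neq // eq_sym.
  rewrite /diff !expnD -!mulnA mulnC [RHS]mulnC; congr (_ * _); last first.
    by apply: eq_card => f; rewrite !inE /P2 /P1 /same -!andbA.
  by rewrite mulnA mulnC; congr (_ * _); rewrite mulnC.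
have cardS1 e : e \in E -> #|S 1 e| <= 3 * T.
  move=> eE; have [h1 h2 h3] := codE _ eE.
  apply: leq_trans (_ : codegree E X Y e + codegree E X Z e + codegree E Y Z e <= _);
    last by lia.
  apply: leq_trans (leq_add (leq_card_setU _ _) (leqnn _)).
  apply: leq_trans (leq_card_setU _ _).
  apply/subset_leq_card/subsetP => e'; rewrite !inE /diff => /andP[-> /=].
  by move: (X e' == X e) (Y e' == Y e) (Z e' == Z e); do 3!case.
have cardS2 e : e \in E -> #|S 2 e| <= 3 * D.
  move=> eE; have [h1 h2 h3] := degE _ eE.
  apply: leq_trans (_ : degree E X e + degree E Y e + degree E Z e <= _);
    last by lia.
  apply: leq_trans (leq_add (leq_card_setU _ _) (leqnn _)).
  apply: leq_trans (leq_card_setU _ _).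
  apply/subset_leq_card/subsetP => e'; rewrite !inE /diff => /andP[-> /=].
  by move: (X e' == X e) (Y e' == Y e) (Z e' == Z e); do 3!case.
have rare j e M : e \in E -> #|S j e| <= M -> 16 * M <= 3 * #|C| ^ j ->
    16 * #|[pred f | keep e f & [exists e' in S j e, same e' e f]]|
      <= 3 * #|keep e|.
  move=> eE SM M16; apply: (@leq_ratio _ _ (#|C| ^ j) M) => //.
    by rewrite expn_gt0 cC expn_gt0 F0.
  apply: leq_trans (_ : #|S j e| * #|keep e| <= _); last by rewrite leq_mul2r SM orbT.
  apply: (@card_union_bound _ _ (keep e) (fun e' => same e' e)) => e'.
  by rewrite !inE => /andP[e'E /eqP <-]; rewrite card_same.
have keep_good e : e \in E ->
    #|keep e| <= 2 * #|[pred f | keep e f & ~~ bad e f]|.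
  move=> eE; apply: half_survives.
  pose B j := #|[pred f | keep e f & [exists e' in S j e, same e' e f]]|.
  have h : #|[pred f | keep e f & bad e f]| <= B 1 + B 2 by apply: card_orb_leq.
  have h1 : 16 * (3 * T) <= 3 * #|C| ^ 1 by rewrite cC expn1 mulnCA leq_mul2l.
  have h2 : 16 * (3 * D) <= 3 * #|C| ^ 2.
    by rewrite cC -expnM mulnCA leq_mul2l.
  have r1 := rare 1 e _ eE (cardS1 e eE) h1.
  have r2 := rare 2 e _ eE (cardS2 e eE) h2.
  have sum16 a b1 b2 k :
    a <= b1 + b2 -> 16 * b1 <= 3 * k -> 16 * b2 <= 3 * k -> 2 * a <= k by lia.
  exact: sum16 h r1 r2.
have [f Ef] : exists f : {ffun V -> C},
    #|E| <= 2 * #|F| ^ 3 * #|[set e in E | keep e f && ~~ bad e f]|.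
  apply: (@exists_large_outcome _ _ E (fun f e => keep e f && ~~ bad e f)).
    by apply/card_gt0P; exists [ffun=> (0, 0)%R].
  move=> e eE; rewrite (card_keep e eE) -mulnA mulnCA.
  by rewrite leq_mul2l keep_good // orbT.
exists [set e in E | keep e f && ~~ bad e f]; split=> //.
  by apply/subsetP => e; rewrite inE => /andP[].
have sub e : e \in [set e in E | keep e f && ~~ bad e f] -> e \in E.
  by rewrite inE => /andP[].
apply: (@berge5_free_of_coloring V _ X Y Z _ _ (@incident F)
  (fun e => f (X e)) (fun e => f (Y e))).
- split=> e; first by move/sub/def_e.
  + by move=> e' /sub eE /sub; apply: XY.
  + by move=> e' /sub eE /sub; apply: XZ.
  + by move=> e' /sub eE /sub; apply: YZ.
- exact: incident_C4_free.
- by move=> e; rewrite !inE => /andP[_ /andP[/andP[]]].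
- by move=> e e' _ _ ->.
- by move=> e e' _ _ ->.
- move=> e e'; rewrite !inE => /andP[_ /andP[/andP[_ /eqP <-] _]].
  by move=> /andP[_ /andP[/andP[_ /eqP <-] _]] ->.
- move=> e e'; rewrite !inE => /andP[eE /andP[/andP[_ /eqP Zf] nbad]].
  move=> /andP[e'E /andP[/andP[_ /eqP Zf'] _]] tch Xf Yf; apply/eqP.
  apply: contraNT nbad => ne; rewrite /bad.
  have s : same e' e f by rewrite /same Xf Yf Zf Zf' Yf !eqxx.
  (* Touching rules out a difference in all three parts, distinctness a difference in none. *)
  suff : (e' \in S 1 e) || (e' \in S 2 e).
    by case/orP=> h; apply/orP; [left | right]; apply/'exists_andP; exists e'.
  have : ~~ [&& X e' == X e, Y e' == Y e & Z e' == Z e].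
    apply: contra ne => /and3P[/eqP h1 /eqP h2 /eqP h3]; apply/eqP.
    by rewrite (def_e _ e'E) h1 h2 h3; apply/esym/def_e.
  rewrite !inE e'E /diff /=; move: tch; rewrite /touching.
  by move: (X e' == X e) (Y e' == Y e) (Z e' == Z e); do 3!case.
Qed.

(** The first component of a colour is a vertex of the affine plane, the second selects the
    matching; a matched [Z e] inherits the plane colour of [Y e]. Keeping [e] costs [#|F|] for the
    incidence and [#|Q|] for the match. Given this, the four failures have probabilities at most
    1/16, 1/16, 1/4 and 1/16, together below 1/2. *)
Lemma heavy_free_subgraph (V : finType) (E : {set {set V}})
    (X Y Z : {set V} -> V) (F : finFieldType) (Q : finType) (D N : nat) :
  tripartite E X Y Z -> 0 < #|Q| ->
  {in E, forall e, degree E X e <= D} ->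
  {in E, forall e, 4 * codegree E Y Z e <= #|F| ^ 2} ->
  {in E, forall e, #|Y @: [set e' in E | Z e' == Z e]| <= N} ->
  {in E, forall e, #|Z @: [set e' in E | Y e' == Y e]| <= N} ->
  16 * N <= #|Q| -> 16 * D <= #|F| ^ 2 * #|Q| ->
  exists E' : {set {set V}}, [/\ E' \subset E,
    is_free (berge_cycle 5) (Hypergraph E') &
    #|E| <= 2 * (#|F| * #|Q|) * #|E'|].
Proof.
move=> triE Q0 degE codE NY NZ N16 D16; have [def_e XY XZ YZ] := triE.
pose C : finType := ((F * F) * Q)%type.
have F0 : 0 < #|F| by apply/card_gt0P; exists 0%R.
have cFF : #|{: F * F}| = #|F| ^ 2 by rewrite card_prod.
have cC : #|C| = #|F| ^ 2 * #|Q| by rewrite card_prod cFF.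
pose keep e : pred {ffun V -> C} :=
  fun f => incident (f (X e)).1 (f (Y e)).1 && ((f (Z e)).2 == (f (Y e)).2).
(* Excluding [bad1] and [bad2] makes the kept pairs [(Y e, Z e)] a matching;
   excluding [bad3] and [bad4] separates the colours of touching edges. *)
pose S1 e := (Y @: [set e' in E | Z e' == Z e]) :\ Y e.
pose bad1 e : pred {ffun V -> C} := fun f =>
  [exists y in S1 e, (f y).2 == (f (Z e)).2].
pose S2 e := (Z @: [set e' in E | Y e' == Y e]) :\ Z e.
pose bad2 e : pred {ffun V -> C} := fun f =>
  [exists z in S2 e, (f z).2 == (f (Y e)).2].
pose S3 e := [set e' in E | [&& Y e' == Y e, Z e' == Z e & X e' != X e]].
pose bad3 e : pred {ffun V -> C} := fun f =>
  [exists e' in S3 e, (f (X e')).1 == (f (X e)).1].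
pose S4 e := [set e' in E | [&& X e' == X e, Y e' != Y e & Z e' != Z e]].
pose bad4 e : pred {ffun V -> C} := fun f =>
  [exists e' in S4 e,
    ((f (Y e')).1 == (f (Y e)).1) && ((f (Z e')).2 == (f (Y e')).2)].
pose bad e : pred {ffun V -> C} := fun f =>
  bad1 e f || (bad2 e f || (bad3 e f || bad4 e f)).
have recolor1 v P g : (forall f c, P (recolor f v c) = P f) ->
    (forall f c, g (recolor f v c) = g f) ->
    #|[pred f : {ffun V -> C} | P f & (f v).1 == g f]| * #|F| ^ 2 = #|P|.
  rewrite -cFF => Pr gr.
  by apply: (@card_recolor V C _ v fst (fun c k => (k, c.2)) P g) => //; case.
have recolor2 v P g : (forall f c, P (recolor f v c) = P f) ->
    (forall f c, g (recolor f v c) = g f) ->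
    #|[pred f : {ffun V -> C} | P f & (f v).2 == g f]| * #|Q| = #|P|.
  move=> Pr gr.
  by apply: (@card_recolor V C _ v snd (fun c k => (c.1, k)) P g) => //; case.
have card_keep e : e \in E -> #|{ffun V -> C}| = #|F| * #|Q| * #|keep e|.
  move=> eE; rewrite -(@card_incident V C F (X e) (Y e) fst
    (fun c k => ((c.1.1, k), c.2))) //; [| by case=> [[]] | exact: XY].
  pose P0 : pred {ffun V -> C} := fun f => incident (f (X e)).1 (f (Y e)).1.
  rewrite -(recolor2 (Z e) P0 (fun f => (f (Y e)).2)).
  - by rewrite -mulnA [#|Q| * _]mulnC mulnC.
  - by move=> f c; rewrite /P0 !recolor_neq ?XZ ?YZ.
  - by move=> f c; rewrite recolor_neq ?YZ.
have rare1 e : e \in E -> 16 * #|[pred f | keep e f & bad1 e f]| <= 1 * #|keep e|.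
  move=> eE; apply: (@leq_ratio _ _ #|Q| N); rewrite ?mul1n //.
  apply: leq_trans (_ : #|S1 e| * #|keep e| <= _); last first.
    rewrite leq_mul2r (leq_trans _ (NY _ eE)) ?orbT //.
    by apply: subset_leq_card; apply: subsetDl.
  apply: (@card_union_bound _ _ (keep e)
     (fun y f => (f y).2 == (f (Z e)).2)) => y; rewrite !inE.
  case/andP=> ny /imsetP[e']; rewrite inE => /andP[e'E _] def_y; subst y.
  have [XYn YZn] := conj (XY _ _ eE e'E) (YZ _ _ e'E eE).
  by rewrite recolor2 // => f c; rewrite /keep !recolor_neq // eq_sym.
have rare2 e : e \in E -> 16 * #|[pred f | keep e f & bad2 e f]| <= 1 * #|keep e|.
  move=> eE; apply: (@leq_ratio _ _ #|Q| N); rewrite ?mul1n //.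
  apply: leq_trans (_ : #|S2 e| * #|keep e| <= _); last first.
    rewrite leq_mul2r (leq_trans _ (NZ _ eE)) ?orbT //.
    by apply: subset_leq_card; apply: subsetDl.
  apply: (@card_union_bound _ _ (keep e)
     (fun z f => (f z).2 == (f (Y e)).2)) => z; rewrite !inE.
  case/andP=> nz /imsetP[e']; rewrite inE => /andP[e'E _] def_z; subst z.
  have [XZn YZn] := conj (XZ _ _ eE e'E) (YZ _ _ eE e'E).
  by rewrite recolor2 // => f c; rewrite /keep !recolor_neq // eq_sym.
have rare3 e : e \in E -> 4 * #|[pred f | keep e f & bad3 e f]| <= 1 * #|keep e|.
  move=> eE; apply: (@leq_ratio _ _ (#|F| ^ 2) (codegree E Y Z e));
    rewrite ?mul1n ?expn_gt0 ?F0 ?codE //.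
  apply: leq_trans (_ : #|S3 e| * #|keep e| <= _); last first.
    rewrite leq_mul2r; apply/orP; right; apply/subset_leq_card/subsetP => e'.
    by rewrite !inE => /and4P[-> -> ->].
  apply: (@card_union_bound _ _ (keep e)
     (fun e' f => (f (X e')).1 == (f (X e)).1)) => e'; rewrite !inE.
  case/and4P=> e'E _ _ nx.
  have [XYn XZn] := conj (XY _ _ e'E eE) (XZ _ _ e'E eE).
  by rewrite recolor1 // => f c; rewrite /keep !recolor_neq // eq_sym.
(* A conflict counts only if [e'] is itself matched; this further factor [#|Q|] is what allows
   degrees of order [#|F| ^ 2 * #|Q|]. *)
have rare4 e : e \in E -> 16 * #|[pred f | keep e f & bad4 e f]| <= 1 * #|keep e|.
  move=> eE; apply: (@leq_ratio _ _ (#|F| ^ 2 * #|Q|) D);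
    rewrite ?mul1n ?muln_gt0 ?expn_gt0 ?F0 //.
  apply: leq_trans (_ : #|S4 e| * #|keep e| <= _); last first.
    rewrite leq_mul2r (leq_trans _ (degE _ eE)) ?orbT //.
    apply/subset_leq_card/subsetP => e'.
    by rewrite !inE => /and4P[-> ->].
  apply: (@card_union_bound _ _ (keep e) (fun e' f =>
     ((f (Y e')).1 == (f (Y e)).1) && ((f (Z e')).2 == (f (Y e')).2))) => e'.
  rewrite !inE; case/and4P=> e'E _ ny nz.
  have [XYn XZn YZn] := And3 (XY _ _ eE e'E) (XZ _ _ eE e'E) (YZ _ _ eE e'E).
  have [ZYn YZn'] := conj (YZ _ _ e'E eE) (YZ _ _ e'E e'E).
  pose P1 : pred {ffun V -> C} := fun f => keep e f && ((f (Y e')).1 == (f (Y e)).1).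
  rewrite -(recolor1 (Y e') (keep e) (fun f => (f (Y e)).1)).
  - rewrite -(recolor2 (Z e') P1 (fun f => (f (Y e')).2)).
    + rewrite -mulnA [_ ^ _ * _]mulnC leq_mul2r; apply/orP; right.
      by apply/subset_leq_card/subsetP => f; rewrite !inE /P1 andbA.
    + by move=> f c; rewrite /P1 /keep !recolor_neq // eq_sym.
    + by move=> f c; rewrite !recolor_neq // eq_sym.
  - by move=> f c; rewrite /keep !recolor_neq // eq_sym.
  - by move=> f c; rewrite !recolor_neq // eq_sym.
have keep_good e : e \in E ->
    #|keep e| <= 2 * #|[pred f | keep e f & ~~ bad e f]|.
  move=> eE; apply: half_survives.
  pose B (R : pred {ffun V -> C}) := #|[pred f | keep e f & R f]|.
  have h : B (bad e) <= B (bad1 e) + (B (bad2 e) + (B (bad3 e) + B (bad4 e))).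
    by do 3!apply: leq_trans (card_orb_leq _ _ _) (leq_add (leqnn _) _).
  have sum16 a b1 b2 b3 b4 k : a <= b1 + (b2 + (b3 + b4)) ->
      16 * b1 <= 1 * k -> 16 * b2 <= 1 * k -> 4 * b3 <= 1 * k ->
      16 * b4 <= 1 * k -> 2 * a <= k by lia.
  exact: sum16 h (rare1 e eE) (rare2 e eE) (rare3 e eE) (rare4 e eE).
have [f Ef] : exists f : {ffun V -> C},
    #|E| <= 2 * (#|F| * #|Q|) * #|[set e in E | keep e f && ~~ bad e f]|.
  apply: (@exists_large_outcome _ _ E (fun f e => keep e f && ~~ bad e f)).
    have [c _] := card_gt0P Q0.
    by apply/card_gt0P; exists [ffun=> ((0, 0)%R, c)].
  move=> e eE; rewrite (card_keep e eE) -[2 * _ * _]mulnA [leqRHS]mulnCA.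
  by rewrite leq_mul2l keep_good // orbT.
exists [set e in E | keep e f && ~~ bad e f]; split=> //.
  by apply/subsetP => e; rewrite inE => /andP[].
have sub e : e \in [set e in E | keep e f && ~~ bad e f] -> e \in E.
  by rewrite inE => /andP[].
have ZtoY : {in [set e in E | keep e f && ~~ bad e f] &, forall e' e,
    Z e' = Z e -> Y e' = Y e}.
  move=> e' e; rewrite !inE => /andP[e'E /andP[/andP[_ Zf'] _]].
  case/andP=> eE /andP[_ nbad] Zee; apply/eqP; apply: contraNT nbad => nY.
  apply/orP; left; apply/'exists_andP; exists (Y e').
  split; last by rewrite -Zee eq_sym Zf'.
  by rewrite !inE nY imset_f // inE e'E Zee /=.
have YtoZ : {in [set e in E | keep e f && ~~ bad e f] &, forall e' e,
    Y e' = Y e -> Z e' = Z e}.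
  move=> e' e; rewrite !inE => /andP[e'E /andP[/andP[_ Zf'] _]].
  case/andP=> eE /andP[_ nbad] Yee; apply/eqP; apply: contraNT nbad => nZ.
  apply/orP; right; apply/orP; left; apply/'exists_andP; exists (Z e').
  split; last by rewrite -Yee Zf'.
  by rewrite !inE nZ imset_f // inE e'E Yee /=.
apply: (@berge5_free_of_coloring V _ X Y Z _ _ (@incident F)
  (fun e => (f (X e)).1) (fun e => (f (Y e)).1)).
- split=> e; first by move/sub/def_e.
  + by move=> e' /sub eE /sub; apply: XY.
  + by move=> e' /sub eE /sub; apply: XZ.
  + by move=> e' /sub eE /sub; apply: YZ.
- exact: incident_C4_free.
- by move=> e; rewrite !inE => /andP[_ /andP[/andP[]]].
- by move=> e e' _ _ ->.
- by move=> e e' _ _ ->.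
- by move=> e e' eE' e'E' /ZtoY ->.
- move=> e e' eE' e'E' tch Xf Yf.
  have [eE e'E] := (sub _ eE', sub _ e'E').
  move: (eE') (e'E'); rewrite !inE => /andP[_ /andP[kp nbad]].
  move=> /andP[_ /andP[/andP[_ Zf'] _]].
  suff [X1 Y1 Z1] : [/\ X e' = X e, Y e' = Y e & Z e' = Z e].
    by rewrite (def_e _ e'E) X1 Y1 Z1; apply/esym/def_e.
  have YXZ : Y e' = Y e -> Z e' = Z e -> X e' = X e.
    move=> Y1 Z1; apply/eqP; apply: contraNT nbad => nX; apply/orP; right.
    apply/orP; right; apply/orP; left; apply/'exists_andP; exists e'.
    by rewrite !inE e'E Y1 Z1 !eqxx nX Xf /=.
  case: (eqVneq (Y e') (Y e)) => [Y1 | nY].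
    by have Z1 := YtoZ _ _ e'E' eE' Y1; split=> //; apply: YXZ.
  case: (eqVneq (Z e') (Z e)) => [Z1 | nZ].
    by have Y1 := ZtoY _ _ e'E' eE' Z1; split=> //; apply: YXZ.
  case/negP: nbad; do 3!(apply/orP; right); apply/'exists_andP; exists e'.
  move: tch; rewrite /touching (negPf nY) (negPf nZ) !orbF => X1.
  by rewrite !inE e'E X1 nY nZ Yf eqxx Zf'.
Qed.

(** * Passing to a tripartite subgraph *)

Lemma tripartiteW (V : finType) (E E' : {set {set V}}) (X Y Z : {set V} -> V) :
  E' \subset E -> tripartite E X Y Z -> tripartite E' X Y Z.
Proof.
move=> /subsetP sEE' [def_e XY XZ YZ]; split.
- by move=> e /sEE'; apply: def_e.
- by move=> e e' /sEE' eE /sEE'; apply: XY.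
- by move=> e e' /sEE' eE /sEE'; apply: XZ.
- by move=> e e' /sEE' eE /sEE'; apply: YZ.
Qed.

Lemma tripartite_swap12 (V : finType) (E : {set {set V}}) (X Y Z : {set V} -> V) :
  tripartite E X Y Z -> tripartite E Y X Z.
Proof.
move=> [def_e XY XZ YZ]; split=> //.
- by move=> e eE; rewrite [_ |: [set X e]]setUC; apply: def_e.
- by move=> e e' eE e'E; rewrite eq_sym XY.
Qed.

Lemma tripartite_swap23 (V : finType) (E : {set {set V}}) (X Y Z : {set V} -> V) :
  tripartite E X Y Z -> tripartite E X Z Y.
Proof.
move=> [def_e XY XZ YZ]; split=> //.
- by move=> e eE; rewrite setUAC; apply: def_e.
- by move=> e e' eE e'E; rewrite eq_sym YZ.
Qed.

Lemma card3_elements (V : finType) (e : {set V}) :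
  #|e| = 3 ->
  exists x y z : V, [/\ e = [set x; y; z], x != y, x != z & y != z].
Proof.
move=> e3; have [x xe] : exists x, x \in e by apply/card_gt0P; rewrite e3.
have /cards2P[y [z [yz def_e]]] : #|e :\ x| == 2.
  by have := cardsD1 x e; rewrite xe e3 add1n => -[<-].
exists x, y, z; split=> //; first by rewrite -setUA -def_e setD1K.
  by have : y \in e :\ x; [rewrite def_e !inE eqxx | rewrite !inE eq_sym => /andP[]].
have : z \in e :\ x; first by rewrite def_e !inE eqxx orbT.
by rewrite !inE eq_sym => /andP[].
Qed.

(** Under a random 3-colouring of the vertices, a fixed ordering of an edge receives the colours 0,
    1, 2 with probability 1/27. *)
Lemma exists_tripartite (V : finType) (v0 : V) (E : {set {set V}}) :
  {in E, forall e : {set V}, #|e| = 3} ->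
  exists (E' : {set {set V}}) (X Y Z : {set V} -> V),
    [/\ E' \subset E, tripartite E' X Y Z & #|E| <= 27 * #|E'|].
Proof.
move=> E3.
pose c (i : nat) : 'I_3 := inord i.
have cE i j : i < 3 -> j < 3 -> (c i == c j) = (i == j).
  by move=> i3 j3; rewrite -val_eqE /= !inordK.
pose rainbow (h : {ffun V -> 'I_3}) (e : {set V}) :=
  [exists x, exists y, exists z,
    [&& e == [set x; y; z], h x == c 0, h y == c 1 & h z == c 2]].
have [h Eh] : exists h, #|E| <= 27 * #|[set e in E | rainbow h e]|.
  apply: exists_large_outcome; first by apply/card_gt0P; exists [ffun=> ord0].
  move=> e eE; have [x [y [z [def_e xy xz yz]]]] := card3_elements (E3 e eE).
  pose P1 : pred {ffun V -> 'I_3} := fun f => true && (f x == c 0).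
  pose P2 : pred {ffun V -> 'I_3} := fun f => P1 f && (f y == c 1).
  rewrite -(@card_recolor_full V _ x predT (fun=> c 0)) //.
  rewrite -(@card_recolor_full V _ y P1 (fun=> c 1)) //; last first.
    by move=> f i; rewrite /P1 recolor_neq.
  rewrite -(@card_recolor_full V _ z P2 (fun=> c 2)) //; last first.
    by move=> f i; rewrite /P2 /P1 !recolor_neq.
  rewrite card_ord -!mulnA mulnC leq_mul2l /=.
  apply/subset_leq_card/subsetP => f.
  rewrite !inE /P2 /P1 /= => /andP[/andP[fx fy] fz].
  apply/existsP; exists x; apply/existsP; exists y; apply/existsP; exists z.
  by rewrite def_e fx fy fz eqxx.
(* The default [v0] is never returned on a rainbow edge, which has exactly one vertex of each
   colour. *)
pose part i (e : {set V}) := odflt v0 [pick v in e | h v == c i].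
have partP e : e \in [set e in E | rainbow h e] ->
    [/\ e = [set part 0 e; part 1 e; part 2 e], h (part 0 e) = c 0,
        h (part 1 e) = c 1 & h (part 2 e) = c 2].
  rewrite inE => /andP[_ /existsP[x /existsP[y /existsP[z]]]].
  case/and4P=> /eqP def_e /eqP hx /eqP hy /eqP hz.
  have partE i v : v \in e -> h v = c i ->
      {in e, forall u, h u = c i -> u = v} -> part i e = v.
    rewrite /part => ve hv uniq_v; case: pickP => [u /andP[ue /eqP hu] | /(_ v)].
      exact: uniq_v.
    by rewrite ve hv eqxx.
  have -> : part 0 e = x.
    apply: partE => //; first by rewrite def_e !inE eqxx.
    move=> u; rewrite def_e !inE -!orbA => /or3P[]/eqP -> //.
      by rewrite hy => /eqP; rewrite cE.
    by rewrite hz => /eqP; rewrite cE.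
  have -> : part 1 e = y.
    apply: partE => //; first by rewrite def_e !inE eqxx orbT.
    move=> u; rewrite def_e !inE -!orbA => /or3P[]/eqP -> //.
      by rewrite hx => /eqP; rewrite cE.
    by rewrite hz => /eqP; rewrite cE.
  have -> : part 2 e = z.
    apply: partE => //; first by rewrite def_e !inE eqxx !orbT.
    move=> u; rewrite def_e !inE -!orbA => /or3P[]/eqP -> //.
      by rewrite hx => /eqP; rewrite cE.
    by rewrite hy => /eqP; rewrite cE.
  by [].
exists [set e in E | rainbow h e], (part 0), (part 1), (part 2); split=> //.
  by apply/subsetP => e; rewrite inE => /andP[].
split=> e; first by case/partP.
- move=> e' /partP[_ h0 _ _] /partP[_ _ h1 _].
  by apply: contraTneq isT => /(congr1 h) /eqP; rewrite h0 h1 cE.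
- move=> e' /partP[_ h0 _ _] /partP[_ _ _ h2].
  by apply: contraTneq isT => /(congr1 h) /eqP; rewrite h0 h2 cE.
- move=> e' /partP[_ _ h1 _] /partP[_ _ _ h2].
  by apply: contraTneq isT => /(congr1 h) /eqP; rewrite h1 h2 cE.
Qed.

(** * Edge classes by codegree *)

(** The fibres are disjoint in [A]. [A] and [B] are separate because codegrees are measured in the
    whole edge set, while values are collected over one class only. *)
Lemma card_imset_fibers (T U : finType) (g : T -> U) (A B : {set T}) (c m : nat) :
  {in B, forall t, c <= m * #|[set t' in A | g t' == g t]|} ->
  #|g @: B| * c <= m * #|A|.
Proof.
move=> fib; rewrite -sum_nat_const.
have -> : #|A| = \sum_u #|[set t' in A | g t' == u]|.
  rewrite -sum1_card (partition_big g predT) //=; apply: eq_bigr => u _.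
  by rewrite -sum1_card; apply: eq_bigl => t; rewrite inE.
rewrite big_distrr big_mkcond /=; apply: leq_sum => u _.
by case: ifP => // /imsetP[t tB ->]; apply: fib.
Qed.

(** Removing [a 0] leaves the same problem for [M./2]. *)
Lemma geometric_sum_leq (n M : nat) (a : nat -> nat) :
  (forall i, i < n -> a i * 2 ^ i <= M) -> \sum_(i < n) a i <= 2 * M.
Proof.
elim: n M a => [|n IH] M a aM; first by rewrite big_ord0.
rewrite big_ord_recl /=.
have h : \sum_(i < n) a (bump 0 i) <= 2 * M./2.
  apply: (IH _ (fun i => a i.+1)) => i lt_in.
  by have := aM i.+1 lt_in; rewrite expnS mulnCA mul2n geq_half_double.
have a0 : a 0 <= M by have := aM 0 isT; rewrite muln1.
by apply: leq_trans (leq_add a0 h) _; lia.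
Qed.

Lemma codegree_subset (V : finType) (E E' : {set {set V}}) (P Q : {set V} -> V) e :
  E' \subset E -> codegree E' P Q e <= codegree E P Q e.
Proof.
move=> /subsetP sE; apply/subset_leq_card/subsetP => e'.
by rewrite !inE => /andP[/sE -> ->].
Qed.

Lemma degree_subset (V : finType) (E E' : {set {set V}}) (P : {set V} -> V) e :
  E' \subset E -> degree E' P e <= degree E P e.
Proof.
move=> /subsetP sE; apply/subset_leq_card/subsetP => e'.
by rewrite !inE => /andP[/sE -> ->].
Qed.

(** An upper bound on the Turan number, inherited by subgraphs; each class of edges is bounded by a
    multiple of the same [M], so the bounds add up. *)
Definition free_bound (V : finType) (E : {set {set V}}) (M : nat) :=
  forall E' : {set {set V}}, E' \subset E ->
    is_free (berge_cycle 5) (Hypergraph E') -> #|E'| <= M.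

(** Here [k + i] is the [j] of the sketch. Each partner of a vertex across [(Y, Z)] accounts for at
    least [4 ^ (k + i) / 16] of its at most [16 ^ k / 16] edges, so there are at most [4 ^ (k - i)]
    partners. *)
Lemma card_heavy_class (V : finType) (E : {set {set V}})
    (X Y Z : {set V} -> V) (D M k i : nat) :
  tripartite E X Y Z ->
  {in E, forall e, [/\ degree E X e <= D, degree E Y e <= D & degree E Z e <= D]} ->
  16 * D <= 16 ^ k -> 0 < k -> i <= k -> free_bound E M ->
  #|[set e in E | trunc_log 4 (16 * codegree E Y Z e) == k + i]| * 2 ^ i
    <= 32 * 8 ^ k * M.
Proof.
move=> triE degE D16 k0 ik freeM; set Ei := [set e in E | _].
have sub : Ei \subset E by apply/subsetP => e; rewrite inE => /andP[].
have EiP e : e \in Ei -> [/\ e \in E, 4 ^ (k + i) <= 16 * codegree E Y Z e &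
    16 * codegree E Y Z e < 4 ^ (k + i).+1].
  rewrite inE => /andP[eE /eqP <-]; split=> //; last exact: trunc_log_ltn.
  apply: trunc_logP => //; rewrite muln_gt0 /=; apply/card_gt0P; exists e.
  by rewrite inE eE !eqxx.
have pow16 : 16 ^ k = 4 ^ (k - i) * 4 ^ (k + i).
  by rewrite -expnD [k + i]addnC addnA subnK // addnn -mul2n (expnM 4 2).
have image_le (P R : {set V} -> V) e : degree E R e <= D ->
    {in [set e' in Ei | R e' == R e], forall t, codegree E Y Z t
       <= #|[set t' in [set e' in E | R e' == R e] | P t' == P t]|} ->
    #|P @: [set e' in Ei | R e' == R e]| <= 4 ^ (k - i).
  move=> degD fib; rewrite -(@leq_pmul2r (4 ^ (k + i))) ?expn_gt0 // -pow16.
  apply: leq_trans D16; apply: leq_trans (_ : 16 * degree E R e <= _); last first.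
    by rewrite leq_mul2l.
  apply: card_imset_fibers => t tB.
  have /EiP[_ h _] : t \in Ei by move: tB; rewrite inE => /andP[].
  by apply: leq_trans h _; rewrite leq_mul2l fib.
have ki0 : 0 < k + i by rewrite addn_gt0 k0.
have [F _ cF] := pPrimePowerField (isT : prime 2) ki0.
have FF : #|F| ^ 2 = 4 ^ (k + i) by rewrite cF -expnM mulnC expnM.
(* The matching uses 16 times as many colours as the bound on partners, for a total cost of
   [32 * 8 ^ k / 2 ^ i]. *)
have [E' [sE' freeE' leE]] : exists E' : {set {set V}}, [/\ E' \subset Ei,
    is_free (berge_cycle 5) (Hypergraph E') &
    #|Ei| <= 2 * (#|F| * #|'I_(4 ^ (k - i).+2)|) * #|E'|].
  apply: (@heavy_free_subgraph V Ei X Y Z F 'I_(4 ^ (k - i).+2) D (4 ^ (k - i))).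
  - exact: tripartiteW triE.
  - by rewrite card_ord expn_gt0.
  - move=> e /EiP[/degE[h _ _] _ _]; exact: leq_trans (degree_subset _ _ sub) h.
  - move=> e /EiP[_ _]; rewrite FF expnS.
    have := codegree_subset Y Z e sub; lia.
  - move=> e /EiP[/degE[_ _ degZ] _ _]; apply: image_le => // t.
    rewrite inE => /andP[_ /eqP Zt]; apply/subset_leq_card/subsetP => t'.
    by rewrite !inE -Zt => /and3P[-> -> ->].
  - move=> e /EiP[/degE[_ degY _] _ _]; apply: image_le => // t.
    rewrite inE => /andP[_ /eqP Yt]; apply/subset_leq_card/subsetP => t'.
    by rewrite !inE -Yt => /and3P[-> -> ->].
  - by rewrite card_ord !expnS mulnA.
  - rewrite card_ord FF; apply: leq_trans D16 _.
    by rewrite pow16 mulnC leq_mul2l leq_exp2l // leqW ?orbT // leqW.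
have := freeM E' (subset_trans sE' sub) freeE'.
rewrite cF card_ord in leE => E'M.
apply: leq_trans (leq_mul leE (leqnn _)) _.
rewrite mulnAC; apply: leq_mul => //.
have -> : 8 ^ k = 2 ^ k * (4 ^ (k - i) * 4 ^ i).
  by rewrite -expnD subnK // -expnMn.
rewrite (expnMn 2 2 i) !expnS expnD; apply: eq_leq; ring.
Qed.

Lemma card_heavy (V : finType) (E : {set {set V}})
    (X Y Z : {set V} -> V) (D M k : nat) :
  tripartite E X Y Z ->
  {in E, forall e, [/\ degree E X e <= D, degree E Y e <= D & degree E Z e <= D]} ->
  16 * D <= 16 ^ k -> 0 < k -> free_bound E M ->
  #|[set e in E | 4 ^ k <= 16 * codegree E Y Z e]| <= 64 * 8 ^ k * M.
Proof.
move=> triE degE D16 k0 freeM.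
pose Ei i := [set e in E | trunc_log 4 (16 * codegree E Y Z e) == k + i].
apply: leq_trans (_ : \sum_(i < k.+1) #|Ei i| <= _); last first.
  have -> : 64 * 8 ^ k * M = 2 * (32 * 8 ^ k * M) by rewrite !mulnA.
  apply: (@geometric_sum_leq _ _ (fun i => #|Ei i|)) => i ik.
  exact: card_heavy_class triE degE D16 k0 ik freeM.
apply: leq_trans (_ : #|\bigcup_(i < k.+1) Ei i| <= _); last first.
  by apply: (big_ind2 (fun (A : {set {set V}}) n => #|A| <= n)); rewrite ?cards0 //
    => A a B b Aa Bb; apply: leq_trans (leq_card_setU A B) (leq_add Aa Bb).
apply/subset_leq_card/subsetP => e; rewrite inE => /andP[eE heavy].
set t := trunc_log 4 (16 * codegree E Y Z e).
have kt : k <= t by rewrite trunc_log_max.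
(* A codegree is at most [D], and [16 * D <= 4 ^ (2 * k)], so no class beyond [i = k] occurs. *)
have tk : t - k < k.+1.
  rewrite ltnS leq_subLR addnn -mul2n -(@leq_exp2l 4) // expnM.
  have [_ degY _] := degE e eE; apply: leq_trans D16.
  apply: leq_trans (_ : 16 * codegree E Y Z e <= _).
    by apply: trunc_logP => //; apply: leq_trans heavy; rewrite expn_gt0.
  rewrite leq_mul2l; apply: leq_trans degY.
  by apply/subset_leq_card/subsetP => e'; rewrite !inE => /and3P[-> ->].
apply/bigcupP; exists (Ordinal tk) => //.
by rewrite inE eE /= subnKC.
Qed.

(** For the field of order [2 ^ k], the fourth and second powers of the order are the thresholds
    [16 ^ k] and [4 ^ k] for degrees and codegrees, and the cube is the cost [8 ^ k]. *)
Lemma card_light (V : finType) (E : {set {set V}})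
    (X Y Z : {set V} -> V) (D M k : nat) :
  tripartite E X Y Z ->
  {in E, forall e, [/\ degree E X e <= D, degree E Y e <= D & degree E Z e <= D]} ->
  16 * D <= 16 ^ k -> 0 < k -> free_bound E M ->
  #|[set e in E | [&& 16 * codegree E X Y e < 4 ^ k,
                      16 * codegree E X Z e < 4 ^ k &
                      16 * codegree E Y Z e < 4 ^ k]]| <= 2 * 8 ^ k * M.
Proof.
move=> triE degE D16 k0 freeM; set L := [set e in E | _].
have sub : L \subset E by apply/subsetP => e; rewrite inE => /andP[].
have [F _ cF] := pPrimePowerField (isT : prime 2) k0.
have Fpow n : #|F| ^ n = (2 ^ n) ^ k by rewrite cF -!expnM mulnC.
have cod P Q e : 16 * codegree E P Q e < 4 ^ k -> codegree L P Q e <= 4 ^ k %/ 16.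
  move=> lt; rewrite leq_divRL // mulnC; apply: leq_trans (ltnW lt).
  by rewrite leq_mul2l codegree_subset.
have [E' [sE' freeE' leE]] : exists E' : {set {set V}}, [/\ E' \subset L,
    is_free (berge_cycle 5) (Hypergraph E') & #|L| <= 2 * #|F| ^ 3 * #|E'|].
  apply: (@light_free_subgraph V L X Y Z F D (4 ^ k %/ 16)).
  - exact: tripartiteW triE.
  - move=> e /(subsetP sub)/degE[hX hY hZ].
    by split; [apply: leq_trans hX | apply: leq_trans hY | apply: leq_trans hZ];
      apply: degree_subset.
  - by move=> e; rewrite inE => /andP[_ /and3P[hXY hXZ hYZ]]; split; apply: cod.
  - by rewrite Fpow.
  - by rewrite Fpow mulnC leq_trunc_div.
apply: leq_trans leE _; rewrite Fpow.
by rewrite leq_mul2l freeM ?orbT // (subset_trans sE').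
Qed.

Lemma card_tripartite_leq (V : finType) (E : {set {set V}})
    (X Y Z : {set V} -> V) (D M k : nat) :
  tripartite E X Y Z ->
  {in E, forall e, [/\ degree E X e <= D, degree E Y e <= D & degree E Z e <= D]} ->
  16 * D <= 16 ^ k -> 0 < k -> free_bound E M ->
  #|E| <= 194 * 8 ^ k * M.
Proof.
move=> triE degE D16 k0 freeM.
have light := card_light triE degE D16 k0 freeM.
have heavyYZ := card_heavy triE degE D16 k0 freeM.
have tri2 := tripartite_swap12 triE.
have heavyXZ : #|[set e in E | 4 ^ k <= 16 * codegree E X Z e]| <= 64 * 8 ^ k * M.
  by apply: card_heavy tri2 _ D16 k0 freeM => e /degE[].
have heavyXY : #|[set e in E | 4 ^ k <= 16 * codegree E X Y e]| <= 64 * 8 ^ k * M.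
  by apply: card_heavy (tripartite_swap12 (tripartite_swap23 triE)) _ D16 k0 freeM
    => e /degE[].
(* 194 is 2 for the light edges plus 64 for each of the three pairs of parts. *)
rewrite (_ : 194 * _ * M = 2 * 8 ^ k * M + (64 * 8 ^ k * M
  + (64 * 8 ^ k * M + 64 * 8 ^ k * M))); last by ring.
set L := [set e in E | _] in light; set HYZ := [set e in E | _] in heavyYZ.
set HXZ := [set e in E | _] in heavyXZ; set HXY := [set e in E | _] in heavyXY.
have /subset_leq_card sub : E \subset L :|: (HXY :|: (HXZ :|: HYZ)).
  apply/subsetP => e eE; rewrite !inE eE /= !ltnNge.
  by do 3!case: (4 ^ k <= _).
apply: leq_trans sub _.
apply: leq_trans (leq_card_setU _ _) (leq_add light _).
apply: leq_trans (leq_card_setU _ _) (leq_add heavyXY _).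
exact: leq_trans (leq_card_setU _ _) (leq_add heavyXZ heavyYZ).
Qed.

(** * From degree bounds to the Turan number *)

Lemma card_edges_leq (V : finType) (E : {set {set V}}) (D M k : nat) :
  {in E, forall e : {set V}, #|e| = 3} ->
  (forall v, #|[set e in E | v \in e]| <= D) ->
  16 * D <= 16 ^ k -> 0 < k -> free_bound E M ->
  #|E| <= 27 * (194 * 8 ^ k * M).
Proof.
move=> E3 degE D16 k0 freeM.
have [-> | [e0 e0E]] := set_0Vmem E; first by rewrite cards0.
have [v0 _] : exists v0, v0 \in e0 by apply/card_gt0P; rewrite E3.
have [E' [X [Y [Z [sE' triE' leE]]]]] := exists_tripartite v0 E3.
apply: leq_trans leE _; rewrite leq_mul2l /=.
have degE' (P : {set V} -> V) e :
    {in E', forall e', P e' \in e'} -> degree E' P e <= D.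
  move=> Pin; apply: leq_trans (degE (P e)); apply/subset_leq_card/subsetP => e'.
  by rewrite !inE => /andP[e'E /eqP <-]; rewrite (subsetP sE') // Pin.
have [def_e _ _ _] := triE'.
apply: (card_tripartite_leq triE' _ D16 k0) => [e _|].
  by split; apply: degE' => e' /def_e {2}->; rewrite !inE eqxx ?orbT.
by move=> E1 sE1; apply: freeM; apply: subset_trans sE'.
Qed.

Lemma turan_ex_bound (H : graph3) (D t : nat) :
  max_degree H <= D -> D < 16 ^ t.+1 ->
  #|edges H| <= 27 * 194 * 64 * 8 ^ t * turan_ex H (berge_cycle 5).
Proof.
move=> degH Dt.
(* The bound is applied with [k = t + 2], one more than [D < 16 ^ t.+1] suggests, to absorb the
   factor 16 in [16 * D]. *)
have e64 : 64 * 8 ^ t = 8 ^ t.+2 by rewrite (expnD 8 2 t).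
rewrite -!mulnA [64 * _]mulnA e64 [194 * _]mulnA.
apply: (@card_edges_leq _ _ D) => //.
- by move=> e eH; apply: graph3_uniform.
- by move=> v; apply: leq_trans degH; apply: (@leq_bigmax _ _ v).
- by rewrite expnS leq_mul2l ltnW.
- move=> E' sE' freeE'; apply: (@leq_bigmax_cond _ _ (fun E : {set {set vertex H}} => #|E|)).
  by rewrite sE' /=; apply/asboolP.
Qed.

Local Open Scope ring_scope.

(** Compare fourth powers: [8 ^ 4 = 16 ^ 3]. *)
Lemma pow8_le_powR (R : realType) (t n : nat) :
  (16 ^ t <= n)%N -> ((8 ^ t)%:R : R) <= n%:R `^ (3 / 4).
Proof.
move=> tn.
rewrite -(@ler_pXn2r _ 4) ?nnegrE ?powR_ge0 //.
rewrite -[leRHS]powR_mulrn ?powR_ge0 // -powRrM.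
rewrite (_ : 3 / 4 * 4%:R = 3%:R) ?divfK ?pnatr_eq0 // powR_mulrn //.
rewrite -!natrX ler_nat -expnM mulnC expnM.
by rewrite (_ : 8 ^ 4 = 16 ^ 3)%N // -expnM mulnC expnM leq_exp2r.
Qed.

Theorem theorem4p2 (R : realType) (eps : R) (heps : 0 < eps) :
  exists Delta0 : nat, forall Delta : nat, (Delta0 <= Delta)%N ->
  forall H : graph3, (max_degree H <= Delta)%N ->
    (Delta%:R `^ (- (3 / 4) - eps) * #|edges H|%:R : R)
      <= (turan_ex H (berge_cycle 5))%:R.
Proof.
pose C : R := (27 * 194 * 64)%N%:R.
(* Chosen above the [eps]-th root of [C], so that [Delta ^ eps] absorbs the constant. *)
exists (Num.truncn (C `^ eps^-1)).+1 => Delta DD H degH.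
have D0 : (0 < Delta)%N by apply: leq_trans DD.
have C_le : C <= Delta%:R `^ eps.
  apply: le_trans (_ : (C `^ eps^-1) `^ eps <= _).
    by rewrite -powRrM mulVf ?powRr1 ?ler0n // lt0r_neq0.
  apply: ge0_ler_powR; rewrite ?nnegrE ?powR_ge0 ?ler0n ?(ltW heps) //.
  by apply/ltW/(lt_le_trans (truncnS_gt _)); rewrite ler_nat.
have /andP[tD Dt] := trunc_log_bounds (isT : 1 < 16)%N D0.
have := turan_ex_bound degH Dt; rewrite -(ler_nat R) 2!natrM => le.
have Dneq : (Delta%:R : R) != 0 by rewrite pnatr_eq0 -lt0n.
rewrite powRD ?Dneq ?implybT // !powRN -invfM mulrC ler_pdivrMr; last first.
  by rewrite mulr_gt0 // powR_gt0 // ltr0n.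
apply: le_trans le _; rewrite mulrC ler_wpM2l ?ler0n // mulrC.
by apply: ler_pM; rewrite ?ler0n // pow8_le_powR.
Qed.
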